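(* Let $G$ be a finite graph. There exists $v_G$ such that for every $v\geq v_G$ with $v\equiv 1,3\pmod 6$ there exists a Steiner triple system $(X,\mathcal{B})$ of order $v$ and a set $P\subseteq X$ containing no block such that the available hypergraph determined by $P$ is a graph isomorphic to $G$ (so that $G$ occurs as a follower of \textsc{Nofil} on this system; the game from this position is equivalent to \textsc{Node Kayles} on $G$).
   Context: A Steiner triple system of order $v$ is a set $X$ of $v$ points with a collection $\mathcal{B}$ of $3$-subsets (blocks) such that every $2$-subset of $X$ lies in exactly one block. \textsc{Nofil} on it: players alternately choose an unplayed point whose addition to the played set does not make any block entirely played; the player with no legal move loses. For a set $P$ of played points containing no block, let $U$ be the set of unplayed points lying in a block with two points of $P$ (unplayable) and $A=X\setminus(P\cup U)$ (available). The available hypergraph has vertex set $A$ and hyperedges: every block contained in $A$, and the $2$-set $B\cap A$ for every block $B$ with exactly one point in $P$ and two in $A$. \textsc{Node Kayles} on a graph: players alternately choose an unplayed vertex not adjacent to any played vertex; the player with no legal move loses. *)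

(* Defs.v *)
From mathcomp Require Import all_boot.

Set Implicit Arguments.
Unset Strict Implicit.
Unset Printing Implicit Defensive.

Definition steiner_triple_system (X : finType) (B : {set {set X}}) : Prop :=
  (forall b, b \in B -> #|b| = 3) /\
  (forall p : {set X}, #|p| = 2 -> exists! b, b \in B /\ p \subset b).

Definition block_free (X : finType) (B : {set {set X}}) (P : {set X}) : bool :=
  [forall b in B, ~~ (b \subset P)].

Definition unplayable (X : finType) (B : {set {set X}}) (P : {set X}) : {set X} :=
  [set x | (x \notin P) && [exists b in B, (x \in b) && (#|b :&: P| == 2)]].

Definition available (X : finType) (B : {set {set X}}) (P : {set X}) : {set X} :=
  ~: (P :|: unplayable B P).

Record hypergraph (T : finType) := Hypergraph {
  hverts : {set T};
  hedges : {set {set T}}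
}.

Definition available_hypergraph (X : finType) (B : {set {set X}}) (P : {set X})
    : hypergraph X :=
  let A := available B P in
  Hypergraph A
    ([set b in B | b \subset A] :|:
     [set b :&: A | b : {set X} in B & (#|b :&: P| == 1) && (#|b :&: A| == 2)]).

Definition is_graph (T : finType) (H : hypergraph T) : Prop :=
  forall E, E \in hedges H -> #|E| = 2.

(* A simple graph is a symmetric irreflexive relation e on a finite type. *)
Definition graph_hypergraph (V : finType) (e : rel V) : hypergraph V :=
  Hypergraph [set: V] [set [set x; y] | x in V, y in V & e x y].

(* Edges are assumed to be sets of vertices, as they are for the two
   hypergraphs above. Since f is defined on all of T1, this is meant for H1 with
   hverts H1 = [set: T1]; in general it could fail for lack of a total f. *)
Definition hypergraph_iso (T1 T2 : finType)
    (H1 : hypergraph T1) (H2 : hypergraph T2) : Prop :=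
  exists f : T1 -> T2,
    [/\ {in hverts H1 &, injective f},
        f @: hverts H1 = hverts H2
      & [set f @: E | E : {set T1} in hedges H1] = hedges H2].

(* Finite impartial games under normal play; move x y means that y is an option
   of x. *)
Record impartial_game := ImpartialGame {
  position : finType;
  move : rel position;
  move_wf : well_founded (fun y x => move x y)
}.

Inductive next_player_wins (T : Type) (m : rel T) (x : T) : Prop :=
  NextPlayerWins y of m x y & (forall z, m y z -> next_player_wins m z).

Definition sum_move (G K : impartial_game) : rel (position G * position K) :=
  fun p q => (move p.1 q.1 && (p.2 == q.2)) || ((p.1 == q.1) && move p.2 q.2).

(* Equality of impartial games: same outcome in every disjunctive sum. *)
Definition game_equiv (G H : impartial_game) (g : position G) (h : position H)
    : Prop :=
  forall (K : impartial_game) (k : position K),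
    next_player_wins (@sum_move G K) (g, k) <->
    next_player_wins (@sum_move H K) (h, k).

(* In both games a position is the set of points played so far. *)
Definition nofil_move (X : finType) (B : {set {set X}}) : rel {set X} :=
  fun P Q => [exists x, [&& x \notin P, Q == x |: P & block_free B Q]].

Definition node_kayles_move (V : finType) (e : rel V) : rel {set V} :=
  fun P Q => [exists x, [&& x \notin P, [forall y in P, ~~ e x y] & Q == x |: P]].

Lemma card_incr_wf (T : finType) (m : rel {set T}) :
  (forall P Q : {set T}, m P Q -> #|P| < #|Q|) ->
  well_founded (fun Q P => m P Q).
Proof.
move=> h P; have [n] := ubnP (#|T| - #|P|).
elim: n P => [P|n IH P lt_n]; first by rewrite ltn0.
apply: Acc_intro => Q mPQ; have ltPQ := h _ _ mPQ; apply: IH.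
have ltPT : #|P| < #|T| := leq_trans ltPQ (max_card _).
exact: leq_trans (ltn_sub2l ltPT ltPQ) lt_n.
Qed.

Lemma nofil_move_wf (X : finType) (B : {set {set X}}) :
  well_founded (fun Q P => nofil_move B P Q).
Proof.
apply: card_incr_wf => P Q /existsP[x /and3P[xP /eqP-> _]].
by rewrite cardsU1 xP.
Qed.

Lemma node_kayles_move_wf (V : finType) (e : rel V) :
  well_founded (fun Q P => node_kayles_move e P Q).
Proof.
apply: card_incr_wf => P Q /existsP[x /and3P[xP _ /eqP->]].
by rewrite cardsU1 xP.
Qed.

Definition nofil (X : finType) (B : {set {set X}}) : impartial_game :=
  ImpartialGame (@nofil_move_wf X B).

Definition node_kayles (V : finType) (e : rel V) : impartial_game :=
  ImpartialGame (@node_kayles_move_wf V e).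

(* P is a follower of the opening position, in which no point is played. *)
Definition nofil_follower (X : finType) (B : {set {set X}}) (P : {set X}) : bool :=
  connect (nofil_move B) set0 P.

(* Main.v *)
Require Import Defs.
From mathcomp Require Import all_boot.
From mathcomp Require Import zify.

Set Implicit Arguments.
Unset Strict Implicit.
Unset Printing Implicit Defensive.

(** In the Bose-Skolem system on [Z_N x {0, 1, 2}] (plus a point at infinity
    when [N] is even), the blocks with two points on level 2 are
    [{(x, 2), (y, 2), (s, 0)}], where [s] encodes [x + y]. Play the points of
    level 0 that encode a set [E] of sums, the points of level 2 in a set [T],
    and infinity. Then [x] and [y] on level 2 are adjacent exactly when [x + y]
    is in [E]. If [T] is independent for this adjacency, its pairwise sums
    exhaust the complement of [E], and [T] dominates all of level 2 but a set
    [A] not adjacent to it, then [A] is exactly the set of available points: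
    pairs from [T] kill the rest of level 0, [T] and [E] kill the rest of level
    2, and [E] kills level 1.

    It remains to find such integers, inside an interval [0, K] that does not
    depend on [N], so that [A] induces the given graph. The vertices get labels
    whose pairwise sums are distinct, built from powers of two; the edge sums go
    into [E], together with further sums that let a small explicit independent
    set dominate every neighbour of [A] outside [A]. Any maximal independent
    extension of that set avoiding [A] and its neighbours serves as [T]. *)

(** * Steiner quasigroups and games *)

(** These are the laws of a Steiner quasigroup, equivalent to a Steiner triple system. *)
Definition steiner_op (X : eqType) (op : X -> X -> X) : Prop :=
  [/\ idempotent_op op, commutative op & forall x y, op x (op x y) = y].

Definition op_block (X : finType) (op : X -> X -> X) (x y : X) : {set X} :=
  [set x; y; op x y].

Definition op_blocks (X : finType) (op : X -> X -> X) : {set {set X}} :=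
  [set op_block op x y | x in X, y in X & x != y].

Lemma irreflexive_neq (T : eqType) (e : rel T) :
  irreflexive e -> forall u v, e u v -> u != v.
Proof. by move=> e_irr u v; apply: contraTneq => ->; rewrite e_irr. Qed.

(** The winning move is copied through [R] when it is made in [G] and repeated when it is made in
    [K]. Every reply in [H] is matched back through [R], so induction on the win applies. *)
Lemma next_player_wins_bisim (G H K : impartial_game)
    (R : position G -> position H -> Prop) :
  (forall x y x', R x y -> move x x' -> exists2 y', move y y' & R x' y') ->
  (forall x y y', R x y -> move y y' -> exists2 x', move x x' & R x' y') ->
  forall g h (k : position K), R g h ->
  next_player_wins (@sum_move G K) (g, k) ->
  next_player_wins (@sum_move H K) (h, k).
Proof.
move=> RGH RHG g h k Rgh; move: {2 3}(g, k) (erefl (g, k)) => p pE w.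
have: R p.1 h /\ p.2 = k by rewrite -pE.
elim: w h k {Rgh pE} => {}p [x k'] mv _ IH h k [Rp Ek]; subst k.
have [y Rxy mvy] : exists2 y, R x y & sum_move (h, p.2) (y, k').
  case/orP: (mv) => /= /andP[m1 m2].
    have [y m1' Ry] := RGH _ _ _ Rp m1; exists y => //.
    by rewrite /sum_move /= m1' m2.
  rewrite -(eqP m1); exists h => //.
  by rewrite /sum_move /= eqxx m2 orbT.
apply: (NextPlayerWins mvy) => -[z k''].
case/orP => /= /andP[m1 m2].
  have [x' m1' Rx'] := RHG _ _ _ Rxy m1.
  by apply: (IH (x', k'')); rewrite /sum_move /= ?m1' ?m2.
apply: (IH (x, k'')); first by rewrite /sum_move /= eqxx m2 orbT.
by rewrite -(eqP m1).
Qed.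

Lemma game_equiv_bisim (G H : impartial_game)
    (R : position G -> position H -> Prop) g h :
  (forall x y x', R x y -> move x x' -> exists2 y', move y y' & R x' y') ->
  (forall x y y', R x y -> move y y' -> exists2 x', move x x' & R x' y') ->
  R g h -> game_equiv g h.
Proof.
move=> RGH RHG Rgh K k; split; first exact: (next_player_wins_bisim RGH RHG).
apply: (@next_player_wins_bisim H G K (fun y x => R x y)) => // x y x' Rxy.
- exact: RHG.
- exact: RGH.
Qed.

Section SteinerOp.

Variables (X : finType) (op : X -> X -> X).
Hypothesis op_steiner : steiner_op op.

Let opxx : idempotent_op op. Proof. by case: op_steiner. Qed.
Let opC : commutative op. Proof. by case: op_steiner. Qed.
Let opK x y : op x (op x y) = y. Proof. by case: op_steiner => _ _; exact. Qed.

Lemma op_neql x y : x != y -> op x y != x.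
Proof. by apply: contraNneq => opE; rewrite -{1}(opxx x) -{2}opE opK. Qed.

Lemma op_neqr x y : x != y -> op x y != y.
Proof. by rewrite eq_sym opC; apply: op_neql. Qed.

Lemma op_blockP b :
  reflect (exists x y, x != y /\ b = op_block op x y) (b \in op_blocks op).
Proof.
apply: (iffP imset2P) => [[x y _]|[x [y [xy ->]]]].
  by rewrite inE => /andP[_ xy] ->; exists x, y.
by exists x y => //; rewrite inE /=.
Qed.

Lemma mem_op_blocks x y : x != y -> op_block op x y \in op_blocks op.
Proof. by move=> xy; apply/op_blockP; exists x, y. Qed.

(** By total symmetry any two points of a block generate the third; uniqueness of the block through
    a pair follows. *)
Lemma op_blockE x y b : b \in op_blocks op -> x \in b -> y \in b -> x != y ->
  b = op_block op x y.
Proof.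
case/op_blockP => p [q [pq ->]].
have h1 : op q (op p q) = p by rewrite (opC p) opK.
have h2 : op p (op p q) = q by rewrite opK.
rewrite !inE => xb yb.
case/orP: xb => [/orP[]|] /eqP->; case/orP: yb => [/orP[]|] /eqP->;
  rewrite ?eqxx // => ne; apply/setP => z;
  rewrite /op_block !inE ?(opC q p) ?(opC (op p q)) ?h1 ?h2;
  by case: (z == p); case: (z == q); case: (z == op p q).
Qed.

Lemma card_op_block x y : x != y -> #|op_block op x y| = 3.
Proof.
move=> xy; rewrite /op_block setUC cardsU1 cards2 xy !inE negb_or.
by rewrite op_neql // op_neqr.
Qed.

Lemma op_blocks_steiner : steiner_triple_system (op_blocks op).
Proof.
split=> [b /op_blockP[x [y [xy ->]]]|p /eqP/cards2P[x [y [xy ->]]]].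
  exact: card_op_block.
exists (op_block op x y); split; first split.
- exact: mem_op_blocks.
- by apply/subsetP => z; rewrite !inE => ->.
- move=> b [bB /subsetP sub]; apply/esym/op_blockE => //.
  + by apply: sub; rewrite !inE eqxx.
  + by apply: sub; rewrite !inE eqxx orbT.
Qed.

Lemma block_freeP (P : {set X}) :
  reflect (forall x y, x != y -> x \in P -> y \in P -> op x y \notin P)
    (block_free (op_blocks op) P).
Proof.
apply: (iffP forall_inP) => [bf x y xy xP yP|h b /op_blockP[x [y [xy ->]]]].
  apply: contra (bf _ (mem_op_blocks xy)) => opP.
  by apply/subsetP => z; rewrite !inE => /orP[/orP[]|] /eqP->.
apply/negP => /subsetP sub; have := h x y xy.
rewrite !sub ?inE ?eqxx ?orbT //; by move=> /(_ isT isT).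
Qed.

Lemma unplayableP (P : {set X}) x :
  reflect (x \notin P /\ exists p q, [/\ p != q, p \in P, q \in P & op p q = x])
    (x \in unplayable (op_blocks op) P).
Proof.
rewrite inE; apply: (iffP andP) => -[xP].
  case/exists_inP => b bB /andP[xb /cards2P[p [q [pq bE]]]]; split => //.
  have /andP[pb pP] : (p \in b) && (p \in P) by rewrite -in_setI bE !inE eqxx.
  have /andP[qb qP] : (q \in b) && (q \in P).
    by rewrite -in_setI bE !inE eqxx orbT.
  exists p, q; split => //; move: xb; rewrite (op_blockE bB pb qb pq) !inE.
  by case/orP => [/orP[]|] /eqP xE; rewrite // xE ?pP ?qP in xP.
case=> p [q [pq pP qP opE]]; split=> //.
apply/exists_inP; exists (op_block op p q); first exact: mem_op_blocks.
rewrite !inE opE eqxx orbT /=; apply/cards2P; exists p, q; split=> //.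
apply/setP => z; rewrite !inE opE.
apply/andP/orP => [[/orP[/orP[]|] /eqP->]|[] /eqP->]; rewrite ?eqxx ?orbT //;
  rewrite ?pP ?qP; try by [left | right].
by rewrite (negPf xP).
Qed.

(** Subsets of block-free sets are block-free, so the points can be played in any order. *)
Lemma block_free_follower (B : {set {set X}}) (P : {set X}) :
  block_free B P -> nofil_follower B P.
Proof.
have [n] := ubnP #|P|; elim: n P => // n IH P ltn bf.
have [->|[x xP]] := set_0Vmem P; first exact: connect0.
have bf' : block_free B (P :\ x).
  apply/forall_inP => b bB; move/forall_inP/(_ b bB): bf; apply: contra.
  by move/subset_trans; apply; apply: subsetDl.
apply: connect_trans (IH _ _ bf') _.
  by move: ltn; rewrite (cardsD1 x) xP.
apply: connect1; apply/existsP; exists x.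
by rewrite !inE eqxx /= setD1K // eqxx bf.
Qed.

(* [f] is the embedding of the graph: its image will be the available set. *)
Section Position.

Variables (V : finType) (e : rel V) (f : V -> X) (P : {set X}).
Hypothesis e_sym : symmetric e.
Hypothesis e_irr : irreflexive e.
Hypothesis f_inj : injective f.
Hypothesis PPP : forall p q, p != q -> p \in P -> q \in P -> op p q \notin P.
Hypothesis fP : forall v, f v \notin P.
Hypothesis PPf :
  forall p q v, p != q -> p \in P -> q \in P -> op p q != f v.
Hypothesis dead : forall x, x \notin P -> (forall v, x != f v) ->
  exists p q, [/\ p != q, p \in P, q \in P & op p q = x].
Hypothesis edgeE : forall u v, u != v -> (op (f u) (f v) \in P) = e u v.
Hypothesis fff : forall u v w, u != v -> op (f u) (f v) != f w.

Local Notation B := (op_blocks op).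
Local Notation Af := [set f v | v in V].

Lemma availableE : available B P = Af.
Proof.
apply/setP => x; rewrite !inE negb_or; apply/andP/imsetP.
  case=> xP xU; have [/existsP[v /eqP xE]|nx] := boolP [exists v, x == f v].
    by exists v.
  case/negP: xU; rewrite xP; have /unplayableP : x \notin P /\
    exists p q, [/\ p != q, p \in P, q \in P & op p q = x].
    split=> //; apply: dead => // v; move: nx; rewrite negb_exists.
    by move/forallP; apply.
  by rewrite inE xP.
case=> v _ ->; split; rewrite ?fP //.
apply/negP => h; have : f v \in unplayable B P by rewrite inE fP.
case/unplayableP => _ [p [q [pq pP qP opE]]].
by have := PPf v pq pP qP; rewrite opE eqxx.
Qed.

(** [fff] rules out blocks inside the available set. A block with one played and two available
    points has [op (f u) (f v)] as its played point, so [edgeE] applies. *)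
Lemma available_edgesE :
  hedges (available_hypergraph B P) =
  [set [set f u; f v] | u in V, v in V & e u v].
Proof.
rewrite /= availableE; apply/setP => E; apply/idP/imset2P.
  rewrite inE => /orP[|/imsetP[b]].
    rewrite inE => /andP[/op_blockP[x [y [xy ->]]] /subsetP sub].
    have /imsetP[u _ xE] : x \in Af by apply: sub; rewrite !inE eqxx.
    have /imsetP[v _ yE] : y \in Af by apply: sub; rewrite !inE eqxx orbT.
    have /imsetP[w _ wE] : op x y \in Af by apply: sub; rewrite !inE eqxx orbT.
    have uv : u != v by apply: contraNneq xy => uv; rewrite xE yE uv.
    by have := fff w uv; rewrite -xE -yE wE eqxx.
  rewrite inE => /and3P[bB /cards1P[p bP] /cards2P[x [y [xy bA]]]] ->.
  have /setIP[xb /imsetP[u _ xE]] : x \in b :&: Af by rewrite bA !inE eqxx.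
  have /setIP[yb /imsetP[v _ yE]] : y \in b :&: Af.
    by rewrite bA !inE eqxx orbT.
  have uv : u != v by apply: contraNneq xy => uv; rewrite xE yE uv.
  exists u v; rewrite ?bA ?xE ?yE // inE /= -edgeE //.
  have /setIP[pb pP] : p \in b :&: P by rewrite bP inE.
  move: pb; rewrite (op_blockE bB xb yb xy) xE yE !inE.
  by case/orP => [/orP[]|] /eqP pE; move: pP; rewrite pE // (negPf (fP _)).
case=> u v _; rewrite inE /= => uv ->.
have ne := irreflexive_neq e_irr uv.
have nf : f u != f v by rewrite (inj_eq f_inj).
have opP : op (f u) (f v) \in P by rewrite edgeE.
have bA : [set f u; f v] = op_block op (f u) (f v) :&: Af.
  apply/setP => z; rewrite !inE; apply/orP/andP => [[] /eqP->|].
  - by rewrite eqxx imset_f.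
  - by rewrite eqxx orbT imset_f.
  case=> /orP[/orP[]|] /eqP->; rewrite ?eqxx; try by [left | right].
  by case/imsetP => w _ wE; have := fff w ne; rewrite wE eqxx.
rewrite inE; apply/orP; right; apply/imsetP; exists (op_block op (f u) (f v)) => //.
rewrite inE mem_op_blocks // -bA cards2 nf eqxx andbT.
apply/cards1P; exists (op (f u) (f v)); apply/setP => z; rewrite !inE.
apply/andP/eqP => [[/orP[/orP[]|] /eqP->]|->]; rewrite ?(negPf (fP _)) //.
by rewrite eqxx orbT.
Qed.

Lemma available_is_graph : is_graph (available_hypergraph B P).
Proof.
move=> E; rewrite available_edgesE => /imset2P[u v _]; rewrite inE => uv ->.
by rewrite cards2 (inj_eq f_inj) (irreflexive_neq e_irr uv).
Qed.

Lemma available_iso :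
  hypergraph_iso (graph_hypergraph e) (available_hypergraph B P).
Proof.
exists f; split.
- by move=> u v _ _; apply: f_inj.
- rewrite /= availableE; apply/setP => x.
  by apply/imsetP/imsetP => -[v _ ->]; exists v.
rewrite available_edgesE; apply/setP => E; apply/imsetP/imset2P.
  case=> F /imset2P[u v _ uv ->] ->; exists u v => //.
  by rewrite imsetU !imset_set1.
case=> u v _ uv ->; exists [set u; v]; first by apply/imset2P; exists u v.
by rewrite imsetU !imset_set1.
Qed.

Let indep (Q : {set V}) := [forall u in Q, [forall v in Q, ~~ e u v]].

Let pos (Q : {set V}) : {set X} := P :|: [set f v | v in Q].

Lemma mem_pos Q v : (f v \in pos Q) = (v \in Q).
Proof.
rewrite inE (negPf (fP _)) /=; apply/imsetP/idP => [[w wQ /f_inj->]//|vQ].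
by exists v.
Qed.

(** By [PPP], [PPf] and [fff], a block inside [pos Q] can only have one point in [P] and two in the
    image of [f], and such a block is an edge. *)
Lemma pos_block_free Q : block_free B (pos Q) = indep Q.
Proof.
apply/block_freeP/idP => [bf|/forall_inP ind x y xy].
  apply/forall_inP => u uQ; apply/forall_inP => v vQ; apply/negP => uv.
  have ne := irreflexive_neq e_irr uv.
  have nf : f u != f v by rewrite (inj_eq f_inj).
  have := bf _ _ nf; rewrite !mem_pos uQ vQ => /(_ isT isT).
  by rewrite inE edgeE // uv.
rewrite !inE !negb_or => /orP[xP|/imsetP[u uQ xE]] /orP[yP|/imsetP[v vQ yE]].
- rewrite PPP //=; apply/imsetP => -[w _ wE].
  by have := PPf w xy xP yP; rewrite wE eqxx.
- have ny : op x (f v) != f v by rewrite op_neqr // -yE.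
  have nx : op x (f v) != x by rewrite op_neql // -yE.
  rewrite yE; apply/andP; split.
    apply/negP => oP; have := PPf v nx oP xP.
    by rewrite opC opK eqxx.
  apply/imsetP => -[w wQ wE].
  have vw : v != w by apply: contraNneq ny => vw; rewrite wE vw.
  move/forall_inP/(_ w wQ): (ind v vQ); rewrite -edgeE //.
  by rewrite -wE (opC x) opK xP.
- have nx : op (f u) y != f u by rewrite op_neql // -xE.
  have ny : op (f u) y != y by rewrite op_neqr // -xE.
  rewrite xE; apply/andP; split.
    apply/negP => oP; have := PPf u ny oP yP.
    by rewrite opC (opC (f u)) opK eqxx.
  apply/imsetP => -[w wQ wE].
  have uw : u != w by apply: contraNneq nx => uw; rewrite wE uw.
  move/forall_inP/(_ w wQ): (ind u uQ); rewrite -edgeE //.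
  by rewrite -wE opK yP.
- have uv : u != v by apply: contraNneq xy => uv; rewrite xE yE uv.
  rewrite xE yE edgeE //; move/forall_inP/(_ v vQ): (ind u uQ) => -> /=.
  by apply/imsetP => -[w _ wE]; have := fff w uv; rewrite wE eqxx.
Qed.

Lemma posU1 v Q : f v |: pos Q = pos (v |: Q).
Proof. by rewrite /pos imsetU1 setUCA. Qed.

Lemma indepU1 v Q : indep Q ->
  indep (v |: Q) = [forall y in Q, ~~ e v y].
Proof.
move=> /forall_inP ind; apply/forall_inP/forall_inP => [h y yQ|h x].
  move/forall_inP: (h v (setU11 _ _)); apply; exact: setU1r.
case/setU1P => [->|xQ]; apply/forall_inP => y /setU1P[->|yQ].
- by rewrite e_irr.
- exact: h.
- by rewrite e_sym h.
- by move/forall_inP: (ind x xQ); apply.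
Qed.

(** By [dead], an unplayed point outside the image of [f] would complete a block, so every legal
    move plays some [f v]. *)
Lemma pos_move Q : indep Q -> forall R,
  nofil_move B (pos Q) R <->
  exists2 Q', node_kayles_move e Q Q' & R = pos Q' /\ indep Q'.
Proof.
move=> ind R; split.
  case/existsP => x /and3P[xQ /eqP-> bf].
  have [/existsP[v /eqP xE]|nx] := boolP [exists v, x == f v].
    rewrite xE posU1 pos_block_free in bf xQ *.
    exists (v |: Q); last by [].
    by apply/existsP; exists v; rewrite -(mem_pos Q) xQ eqxx -indepU1 // bf.
  have xP : x \notin P by apply: contra xQ => xP; rewrite inE xP.
  have [v|p [q [pq pP qP opE]]] := dead xP.
    by move: nx; rewrite negb_exists => /forallP; apply.
  move/block_freeP/(_ _ _ pq): bf.
  by rewrite opE !inE pP qP eqxx !orbT => /(_ isT isT).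
case=> Q' /existsP[v /and3P[vQ vn /eqP->]] [-> ind'].
apply/existsP; exists (f v).
by rewrite mem_pos vQ posU1 eqxx pos_block_free ind'.
Qed.

Lemma nofil_node_kayles : @game_equiv (nofil B) (node_kayles e) P set0.
Proof.
have P0 : P = pos set0 by rewrite /pos imset0 setU0.
have ind0 : indep set0 by apply/forall_inP => u; rewrite inE.
apply: (@game_equiv_bisim (nofil B) (node_kayles e)
  (fun p (Q : {set V}) => p = pos Q /\ indep Q)) => //=.
- by move=> x y x' [-> ind] /(pos_move ind).
- move=> x y y' [-> ind] mv; have ind' : indep y'.
    by case/existsP: mv => v /and3P[_ vn /eqP->]; rewrite indepU1.
  by exists (pos y') => //; apply/(pos_move ind); exists y'.
Qed.

Lemma steiner_op_position :
  [/\ block_free B P,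
      is_graph (available_hypergraph B P) /\
        hypergraph_iso (graph_hypergraph e) (available_hypergraph B P),
      nofil_follower B P
    & @game_equiv (nofil B) (node_kayles e) P set0].
Proof.
have bf : block_free B P by apply/block_freeP.
split=> //; first by split; [apply: available_is_graph|apply: available_iso].
  exact: block_free_follower.
exact: nofil_node_kayles.
Qed.

End Position.
End SteinerOp.

(** * Sum graphs on an interval *)

(** Uniqueness of binary expansions: parity decides whether the smaller exponents vanish, and
    otherwise both sides are halved. *)
Lemma pow2_sum_inj_lt i j k l : i < j -> k < l ->
  2 ^ i + 2 ^ j = 2 ^ k + 2 ^ l -> i = k /\ j = l.
Proof.
elim: i j k l => [|i IH] [|j] // [|k] [|l] // ij kl; rewrite !expnS ?expn0 => E.
- have {}E : 2 ^ j = 2 ^ l by lia.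
  by split=> //; congr _.+1; apply/eqP; rewrite -(eqn_exp2l (m := 2)) // E.
- by exfalso; lia.
- by exfalso; lia.
- by have [] : i = k /\ j = l; [apply: IH => //; lia | move=> -> ->].
Qed.

Lemma pow2_sum_inj i j k l : i != j -> k != l ->
  2 ^ i + 2 ^ j = 2 ^ k + 2 ^ l -> (i = k /\ j = l) \/ (i = l /\ j = k).
Proof.
rewrite !neq_ltn => /orP[] ij /orP[] kl E.
- by left; apply: pow2_sum_inj_lt.
- by right; apply: pow2_sum_inj_lt; lia.
- by right; have [] : j = k /\ i = l; [apply: pow2_sum_inj_lt; lia|].
- by left; have [] : j = l /\ i = k; [apply: pow2_sum_inj_lt; lia|].
Qed.

(* Two distinct labels are adjacent when their sum satisfies [sum_edge]. The
   vertices of the graph have labels [al v], and [core] is an independent set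
   whose pairwise sums already give every non-edge sum up to [2 * K]. The point
   [t1] of [core] is adjacent to everything near the labels except the labels
   themselves. *)
Section SumGraph.

Variables (V : finType) (e : rel V) (h b t1 K : nat) (al : V -> nat).

Definition is_label (x : nat) := [exists v, x == al v].
Definition is_edge_sum (z : nat) :=
  [exists u, exists v, e u v && (z == al u + al v)].

Hypothesis h_ge2 : 2 <= h.
Hypothesis bE : b = 32 * h.
Hypothesis t1E : t1 = 16 * b.
Hypothesis KE : K = 4 * t1.
Hypothesis al_inj : injective al.
Hypothesis al_bnd : forall v, b + h + 2 <= al v <= b + 2 * h.
Hypothesis is_label_step : forall x, is_label x -> ~~ is_label x.+1.
Hypothesis is_edge_sumE : forall u v, u != v ->
  is_edge_sum (al u + al v) = e u v.

Lemma is_labelP x : reflect (exists v, x = al v) (is_label x).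
Proof. by apply: (iffP existsP) => -[v /eqP]; exists v => //; apply/eqP. Qed.

Lemma is_label_al v : is_label (al v). Proof. by apply/is_labelP; exists v. Qed.

Lemma is_label_bnd x : is_label x -> b + h + 2 <= x <= b + 2 * h.
Proof. by case/is_labelP => v ->. Qed.

Lemma is_edge_sum_bnd z : is_edge_sum z ->
  2 * b + 2 * h + 4 <= z <= 2 * b + 4 * h.
Proof.
case/existsP => u /existsP[v /andP[_ /eqP->]].
by have := al_bnd u; have := al_bnd v; lia.
Qed.

(** This is the set of numbers that are not sums of two distinct points of [core]. The window at
    [t1 + b], punctured at the translated labels, makes [t1] adjacent to the non-labels near [b].
    The last disjunct puts all large codes into [E], whatever the modulus. *)
Definition sum_edge z := [|| z < 8 * h, is_edge_sum z, 8 * b - 2 <= z < t1,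
  t1 < z < t1 + 8 * h, (t1 + b <= z < t1 + b + 4 * h) && ~~ is_label (z - t1)
  | 2 * K <= z].

(** Since 0 is present, each other point is itself a sum. The gap below [8 * h] makes shifts by the
    second piece jump over the edge sums and over the punctured window, both of width less than
    [4 * h]. *)
Definition core x := [|| x == 0, 8 * h <= x < b,
  (2 * b - 2 <= x < 4 * b) && ~~ is_edge_sum x, x == t1,
  (t1 <= x) && is_label (x - t1) | t1 + b + 4 * h <= x <= K].

(** Only interval bounds are kept, in a form suited to linear arithmetic. *)
Lemma sum_edge_bnd z : sum_edge z -> z < 8 * h \/
  2 * b + 2 * h < z <= 2 * b + 4 * h \/
  8 * b - 2 <= z < t1 \/ t1 < z < t1 + 8 * h \/
  t1 + b <= z < t1 + b + 4 * h \/ 2 * K <= z.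
Proof.
case/or4P => [zE|/is_edge_sum_bnd zE|zE|/or3P[zE|/andP[zE _]|zE]].
- by left.
- by right; left; lia.
- by do 2 right; left.
- by do 3 right; left.
- by do 4 right; left.
- by do 5 right.
Qed.

Lemma core_bnd x : core x -> x = 0 \/ 8 * h <= x < b \/
  2 * b - 2 <= x < 4 * b \/ x = t1 \/
  t1 + b <= x < t1 + b + 4 * h \/ t1 + b + 4 * h <= x <= K.
Proof.
case/or4P => [/eqP xE|xE|/andP[xE _]|/or3P[/eqP xE|/andP[xE1 /is_label_bnd xE]|xE]].
- by left.
- by right; left.
- by do 2 right; left.
- by do 3 right; left.
- by do 4 right; left; lia.
- by do 5 right.
Qed.

Lemma core_not_sum_edge y : 0 < y -> core y -> ~~ sum_edge y.
Proof.
move=> y0; rewrite /sum_edge.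
case/or4P => [yE|yE|/andP[yE /negPf->]|/or3P[/eqP->|/andP[yE1 yA]|yE]].
- lia.
- by have := @is_edge_sum_bnd y; case: is_edge_sum; lia.
- lia.
- by have := @is_edge_sum_bnd t1; case: is_edge_sum; lia.
- by have := @is_edge_sum_bnd y; rewrite yA; have := is_label_bnd yA;
    case: is_edge_sum; lia.
- by have := @is_edge_sum_bnd y; case: is_edge_sum; lia.
Qed.

(** For positive [x] the interval bounds alone exclude an edge; the exact edge sums and labels
    matter only when [x] is 0. *)
Lemma core_indep x y : x < y -> core x -> core y -> ~~ sum_edge (x + y).
Proof.
move=> xy hx hy; have [x0|x_gt0] := posnP x.
  by rewrite x0; apply: core_not_sum_edge => //; lia.
apply/negP => /sum_edge_bnd hE.
case: (core_bnd hx) => [?|[?|[?|[?|[?|?]]]]];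
  case: (core_bnd hy) => [?|[?|[?|[?|[?|?]]]]];
  case: hE => [?|[?|[?|[?|[?|?]]]]]; lia.
Qed.

(** The bounds suffice except for [t1], which moves a label into the window at [t1 + b], exactly
    onto a puncture. *)
Lemma core_not_adj x v : core x -> ~~ sum_edge (x + al v).
Proof.
have va := al_bnd v.
move=> hx; apply/negP => hE.
have [xA|xR] : is_label (x + al v - t1) /\ x = t1 \/
    x < b \/ 2 * b - 2 <= x /\ x != t1.
  case: (core_bnd hx) => [?|[?|[?|[xE|[?|?]]]]]; try by [right; lia].
  by left; rewrite xE addKn is_label_al.
  case: xA => xA xE; rewrite xE in hE xA; move: hE.
  rewrite /sum_edge xA; have := @is_edge_sum_bnd (t1 + al v); case: is_edge_sum; lia.
have [/existsP[u /existsP[w /andP[_ /eqP xE]]]|nE] := boolP (is_edge_sum (x + al v)).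
  have := al_bnd u; have := al_bnd w; case: (core_bnd hx) => [?|[?|[?|[?|[?|?]]]]]; lia.
move: hE; rewrite /sum_edge (negPf nE) /=.
case: (is_label _); case: (core_bnd hx) => [?|[?|[?|[?|[?|?]]]]]; lia.
Qed.

Lemma core_cover z : z <= 2 * K -> ~~ sum_edge z ->
  exists x y, [/\ x < y, core x, core y & x + y = z].
Proof.
have T00 : core 0 by [].
have TL x : 8 * h <= x < b -> core x by rewrite /core => ->; rewrite orbT.
have TZ x : 2 * b - 2 <= x < 4 * b -> ~~ is_edge_sum x -> core x.
  by rewrite /core => -> ->; rewrite !orbT.
have Tt : core t1 by rewrite /core eqxx !orbT.
have TH x : t1 + b + 4 * h <= x <= K -> core x by rewrite /core => ->; rewrite !orbT.
have TA v : core (t1 + al v).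
  by rewrite /core addKn is_label_al; have := al_bnd v; lia.
have nEG x : ~~ (2 * b + 2 * h < x <= 2 * b + 4 * h) -> ~~ is_edge_sum x.
  by apply: contra => /is_edge_sum_bnd; lia.
move=> zK; rewrite /sum_edge !negb_or -!leqNgt => /and5P[z1 z2 z3 z4 /andP[z5 z6]].
have zA : t1 + b <= z < t1 + b + 4 * h -> is_label (z - t1).
  by move=> zb; move: z5; rewrite zb negbK.
have {}z3 : z < 8 * b - 2 \/ t1 <= z by lia.
have {}z4 : z <= t1 \/ t1 + 8 * h <= z by lia.
clear z5; case: z3 => z3; last first.
  have [?|?] := leqP z t1.
    by exists 0, t1; split; [|apply: T00|apply: Tt|]; lia.
  have {}z4 : t1 + 8 * h <= z by lia.
  have [?|?] := ltnP z (t1 + b).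
    by exists (z - t1), t1; split; [|apply: TL|apply: Tt|]; lia.
  have [?|?] := ltnP z (t1 + b + 4 * h).
    have /is_labelP[v vE] : is_label (z - t1) by apply: zA; lia.
    exists 0, z; split; [lia|apply: T00| |by []].
    by have -> : z = t1 + al v by lia.
  have [?|?] := leqP z K.
    by exists 0, z; split; [|apply: T00|apply: TH|]; lia.
  have [?|?] := ltnP z (K + (t1 + b + 4 * h)).
    by exists (t1 + b + 4 * h), (z - (t1 + b + 4 * h)); split;
      [|apply: TH|apply: TH|]; lia.
  by exists (z - K), K; split; [|apply: TH|apply: TH|]; lia.
clear z4 zA.
have [?|?] := ltnP z b.
  by exists 0, z; split; [|apply: T00|apply: TL|]; lia.
(* Two distinct points below [b] have sum at most [2 * b - 3], which is why the third piece of
   [core] starts at [2 * b - 2]. *)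
have [?|?] := ltnP z (2 * b - 2).
  have [?|?] := ltnP z (b + 8 * h).
    by exists (8 * h), (z - 8 * h); split; [|apply: TL|apply: TL|]; lia.
  by exists (z - (b - 1)), (b - 1); split; [|apply: TL|apply: TL|]; lia.
have [?|?] := ltnP z (4 * b).
  by exists 0, z; split; [|apply: T00|apply: TZ|]; lia.
(* From here on one summand is a fixed anchor, chosen so that the other summand stays above the edge
   sums. *)
have [?|?] := ltnP z (4 * b + 16 * h).
  by exists (16 * h), (z - 16 * h); split;
    [|apply: TL|apply: TZ|]; rewrite ?nEG; lia.
have [?|?] := ltnP z (6 * b + 4 * h).
  by exists (2 * b + 5 * h), (z - (2 * b + 5 * h)); split;
    [|apply: TZ|apply: TZ|]; rewrite ?nEG; lia.
by exists (z - (4 * b - 1)), (4 * b - 1); split;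
  [|apply: TZ|apply: TZ|]; rewrite ?nEG; lia.
Qed.

(** The cases follow the disjuncts of [sum_edge]. An edge sum puts [y] near [b], where [t1]
    dominates all non-labels. In the range [mid], the interval below [t1] is reached by adding 0 or
    [3 * b + 4 * h]. From [t1] on, [b - 1] or [b - 2] serves. *)
Lemma core_dominates y :
  ~~ is_label y -> (exists v, sum_edge (y + al v)) -> y <= K ->
  exists t, [/\ core t, t != y & sum_edge (t + y)].
Proof.
have T00 : core 0 by [].
have TL x : 8 * h <= x < b -> core x by rewrite /core => ->; rewrite orbT.
have TZ x : 2 * b + 5 * h <= x < 4 * b -> core x.
  move=> xb; have nx : ~~ is_edge_sum x by apply/negP => /is_edge_sum_bnd; lia.
  by rewrite /core nx; lia.
have Tt : core t1 by rewrite /core eqxx !orbT.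
have E2 z : 8 * b - 2 <= z < t1 -> sum_edge z by rewrite /sum_edge => ->; rewrite !orbT.
have EF z : t1 + b <= z < t1 + b + 4 * h -> ~~ is_label (z - t1) -> sum_edge z.
  by rewrite /sum_edge => -> ->; rewrite !orbT.
have mid : 6 * b + 8 * h <= y < t1 ->
    exists t, [/\ core t, t != y & sum_edge (t + y)].
  move=> yb; have [?|?] := ltnP y (8 * b - 2).
    by exists (3 * b + 4 * h); split; [apply: TZ| |apply: E2]; lia.
  by exists 0; split; [apply: T00| |apply: E2]; lia.
move=> nyA [v vE] yK; have va := al_bnd v.
case/or4P: vE => [?|/existsP[u /existsP[w /andP[_ /eqP yE]]]|?|/or3P[?|/andP[yb yA]|?]].
- lia.
- have := al_bnd u; have := al_bnd w => wa ua.
  by exists t1; split; [apply: Tt| |apply: EF; rewrite ?addKn //]; lia.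
- by apply: mid; lia.
- by apply: mid; lia.
- have [?|y1] := ltnP y t1; first by apply: mid; lia.
  have y2 : y != t1.
    by apply: contraNneq yA => ->; rewrite addKn is_label_al.
  (* Labels are never consecutive, so at most one of [b - 1] and [b - 2] hits a puncture. *)
  have [yA1|yA1] := boolP (is_label (b - 1 + y - t1)).
    have yb1 := is_label_bnd yA1.
    exists (b - 2); split; [apply: TL; lia|lia|apply: EF; first lia].
    apply: contraL yA1 => /is_label_step.
    by have -> : (b - 2 + y - t1).+1 = b - 1 + y - t1 by lia.
  by exists (b - 1); split; [apply: TL| |apply: EF => //]; lia.
- lia.
Qed.

(** A point outside [T] and the labels is dominated by [core] if it is adjacent to a label, and by
    maximality of [M] otherwise. *)
Lemma sum_graph_of_scale : exists (f : V -> nat) (T E : pred nat),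
  [/\ injective f, forall v, f v <= K /\ ~~ T (f v),
      [/\ T 0, T K, forall x, T x -> x <= K & forall z, 2 * K <= z -> E z],
      [/\ forall x y, T x -> T y -> x != y -> ~~ E (x + y),
          forall x v, T x -> ~~ E (x + f v)
        & forall u v, u != v -> E (f u + f v) = e u v]
    & (forall y, y <= K -> ~~ T y -> (forall v, y != f v) ->
         exists t, [/\ T t, t != y & E (t + y)]) /\
      (forall z, ~~ E z -> exists x y, [/\ x != y, T x, T y & x + y = z])].
Proof.
pose ok (M : {set 'I_K.+1}) :=
  [forall x in M, [forall y in M, (x != y) ==> ~~ sum_edge (x + y)]
    && [forall v, ~~ sum_edge (x + al v)] && ~~ is_label x].
pose M0 : {set 'I_K.+1} := [set x : 'I_K.+1 | core x].
have okM0 : ok M0.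
  apply/forall_inP => x; rewrite inE => Tx; rewrite -andbA; apply/and3P; split.
  - apply/forall_inP => y; rewrite inE => Ty; apply/implyP; rewrite neq_ltn.
    by case/orP => xy; [|rewrite addnC]; apply: core_indep.
  - by apply/forallP => v; apply: core_not_adj.
  - apply/negP => /is_label_bnd xb; case: (core_bnd Tx) => [?|[?|[?|[?|[?|?]]]]]; lia.
have [M /maxsetP[okM maxM] /subsetP sM] := maxset_exists okM0.
have okM2 x y : x \in M -> y \in M -> x != y -> ~~ sum_edge (x + y).
  move=> xM yM; move/forall_inP: okM => /(_ x xM) /andP[/andP[/forall_inP h1 _] _].
  by apply: (implyP (h1 y yM)).
have okMA x v : x \in M -> ~~ sum_edge (x + al v).
  by move=> xM; move/forall_inP: okM => /(_ x xM) /andP[/andP[_ /forallP]].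
have okMn x : x \in M -> ~~ is_label x.
  by move=> xM; move/forall_inP: okM => /(_ x xM) /andP[].
pose T x := (x <= K) && (inord x \in M).
have coreT x : x <= K -> core x -> T x.
  by move=> xK Tx; rewrite /T xK sM // inE inordK.
have coreK x : core x -> x <= K by case/core_bnd; lia.
exists al, T, sum_edge; split=> //.
- move=> v; have := al_bnd v => va; split; first by lia.
  apply/negP => /andP[vK /okMn]; by rewrite inordK // is_label_al.
- split.
  + by apply: coreT.
  + by apply: coreT => //; rewrite /core; lia.
  + by move=> x /andP[].
  + by move=> z; rewrite /sum_edge; lia.
- split=> //.
  + move=> x y /andP[xK xM] /andP[yK yM] xy.
    have := okM2 _ _ xM yM; rewrite !inordK //; apply.
    by apply: contraNneq xy => /(congr1 val); rewrite /= !inordK // => ->.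
  + by move=> x v /andP[xK xM]; have := okMA _ v xM; rewrite inordK.
  + move=> u v uv; rewrite -is_edge_sumE // /sum_edge.
    by have := al_bnd u; have := al_bnd v;
    case: (is_edge_sum _); case: (is_label _); lia.
split=> [y yK nTy nyA|z nEz]; last first.
  have zK : z <= 2 * K by move: nEz; rewrite /sum_edge; lia.
  have [x [y [xy Tx Ty xyE]]] := core_cover zK nEz.
  by exists x, y; rewrite neq_ltn xy !coreT ?coreK.
have nA : ~~ is_label y by apply/is_labelP => -[v yE]; have := nyA v; rewrite yE eqxx.
have [/existsP yN|yN] := boolP [exists v, sum_edge (y + al v)].
  by have [t [Tt ty Et]] := core_dominates nA yN yK; exists t; rewrite coreT ?coreK.
have [/exists_inP[x xM /andP[xy xE]]|nx] :=
    boolP [exists x in M, (nat_of_ord x != y) && sum_edge (x + y)].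
  by exists x; rewrite /T -ltnS ltn_ord inord_val.
pose y' : 'I_K.+1 := inord y; have y'E : y' = y :> nat by rewrite inordK.
have yM : y' \notin M by move: nTy; rewrite /T yK.
have nE x : x \in M -> x != y' -> ~~ sum_edge (x + y).
  move=> xM xy; move: nx; rewrite negb_exists_in => /forall_inP/(_ x xM).
  by rewrite negb_and -y'E (inj_eq val_inj) xy.
suff okyM : ok (y' |: M).
  by case/negP: yM; rewrite -(maxM _ okyM) ?setU11 ?subsetUr.
apply/forall_inP => x /setU1P[->|xM]; rewrite -andbA ?y'E.
  apply/and3P; split=> //; last first.
    by apply/forallP => v; move: yN; rewrite negb_exists => /forallP.
  apply/forall_inP => z /setU1P[->|zM]; first by rewrite eqxx.
  by rewrite eq_sym addnC; apply/implyP; apply: nE.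
apply/and3P; split; [|by apply/forallP => v; apply: okMA|exact: okMn].
apply/forall_inP => z /setU1P[->|zM]; apply/implyP; first by rewrite y'E; apply: nE.
exact: okM2.
Qed.

End SumGraph.

Lemma sum_graph (V : finType) (e : rel V) :
  symmetric e -> irreflexive e ->
  exists (K : nat) (f : V -> nat) (T E : pred nat),
  [/\ injective f, forall v, f v <= K /\ ~~ T (f v),
      [/\ T 0, T K, forall x, T x -> x <= K & forall z, 2 * K <= z -> E z],
      [/\ forall x y, T x -> T y -> x != y -> ~~ E (x + y),
          forall x v, T x -> ~~ E (x + f v)
        & forall u v, u != v -> E (f u + f v) = e u v]
    & (forall y, y <= K -> ~~ T y -> (forall v, y != f v) ->
         exists t, [/\ T t, t != y & E (t + y)]) /\
      (forall z, ~~ E z -> exists x y, [/\ x != y, T x, T y & x + y = z])].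
Proof.
move=> e_sym e_irr.
pose h := 2 ^ #|V|.+1; pose b := 32 * h; pose t1 := 16 * b.
(* Exponents start at 1, so all labels are even, hence not consecutive. Sums of two distinct powers
   of two determine the pair, so the edge sums encode exactly [e]. *)
pose al (v : V) := b + h + 2 ^ (enum_rank v).+1.
exists (4 * t1); apply: (@sum_graph_of_scale V e h b t1 (4 * t1) al) => //.
- by rewrite /h expnS; have := expn_gt0 2 #|V|; lia.
- move=> u v /addnI E; apply: enum_rank_inj; apply: val_inj => /=.
  by apply/eqP; rewrite -eqSS -(eqn_exp2l (m := 2)) // E.
- move=> v; rewrite /al; have : 2 ^ (enum_rank v).+1 <= h.
    by rewrite /h leq_exp2l // ltnS; apply: ltnW; apply: ltn_ord.
  have : 0 < 2 ^ enum_rank v by rewrite expn_gt0.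
  rewrite expnS; lia.
- move=> x /existsP[u /eqP->]; apply/negP => /existsP[v].
  rewrite /al !expnS; lia.
- have e_neq u v : e u v -> u != v by apply: contraTneq => ->; rewrite e_irr.
  move=> u v uv; apply/existsP/idP => [[u' /existsP[v' /andP[e' /eqP E]]]|euv].
    have {}E : 2 ^ (enum_rank u).+1 + 2 ^ (enum_rank v).+1 =
        2 ^ (enum_rank u').+1 + 2 ^ (enum_rank v').+1.
      by move: E; rewrite /al; lia.
    have ne (x y : V) : x != y -> (enum_rank x).+1 != (enum_rank y).+1.
      by rewrite eqSS (inj_eq val_inj) (inj_eq enum_rank_inj).
    have := pow2_sum_inj (ne _ _ uv) (ne _ _ (e_neq _ _ e')) E.
    by case=> -[[/val_inj/enum_rank_inj->] [/val_inj/enum_rank_inj->]];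
      rewrite // e_sym.
  by exists u; apply/existsP; exists v; rewrite euv eqxx.
Qed.

(** * The Bose and Skolem constructions *)

Local Notation next_level := (@ordS 3).

Lemma next_levelK i : next_level (next_level (next_level i)) = i.
Proof. by apply: val_inj; case: i => [[|[|[|]]]] //. Qed.

Lemma next_level_neq i : (next_level i == i) = false.
Proof.
by apply/negP => /eqP/(congr1 val); case: i => [[|[|[|]]]] //.
Qed.

Lemma next_level2_neq i : (next_level (next_level i) == i) = false.
Proof.
by apply/negP => /eqP/(congr1 val); case: i => [[|[|[|]]]] //.
Qed.

Lemma next_levelP i j : [\/ j = i, j = next_level i | i = next_level j].
Proof.
have [->|ij] := eqVneq j i; first by constructor 1.
have [->|nij] := eqVneq j (next_level i); first by constructor 2.
constructor 3; apply: val_inj; move: ij nij; rewrite -!(inj_eq val_inj).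
by case: i => [[|[|[|]]]] //= hi; case: j => [[|[|[|]]]] //=.
Qed.

(* Points of [I], of which there is at most one, play the part of the point at
   infinity of Skolem's construction; Bose's construction is the case where [I]
   is empty and [c] is idempotent. *)
Section Skolem.

Variables (L I : finType) (c d : L -> L -> L) (root : L -> L).
Hypothesis cC : commutative c.
Hypothesis cdK : forall x y, c x (d x y) = y.
Hypothesis dcK : forall x y, d x (c x y) = y.
Hypothesis I1 : forall o o' : I, o = o'.
Hypothesis I_inh : forall x, c x x != x -> inhabited I.
Hypothesis sq_idem : forall x, c (c x x) (c x x) = c x x.
Hypothesis sqK : forall x, c x x != x -> root (c x x) = x.
Hypothesis rootK : inhabited I -> forall x, c x x = x -> c (root x) (root x) = x.
Hypothesis root_neq : inhabited I -> forall x, c x x = x -> root x != x.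

Local Notation X := (L * 'I_3 + I)%type.

(* The third point of the block through [(x, i)] and [(y, i + 1)]; the last
   [else] is a junk value, never reached. *)
Definition skolem_up (x y : L) (i : 'I_3) : X :=
  if d x y != x then inl (d x y, i)
  else if x == y then inl (x, next_level (next_level i))
  else if [pick o : I] is Some o then inr o else inl (x, i).

Definition skolem_inf (x : L) (i : 'I_3) : X :=
  if c x x == x then inl (root x, next_level (next_level i))
  else inl (c x x, next_level i).

(** The blocks are the triples [(x, i)], [(y, i)], [(c x y, i + 1)] with distinct [x] and [y], the
    vertical triples over idempotents, and the triples of infinity, [(x, i)], [(c x x, i + 1)] with
    [x] not idempotent. *)
Definition skolem_op (p q : X) : X :=
  match p, q with
  | inl (x, i), inl (y, j) =>
      if i == j then (if x == y then p else inl (c x y, next_level i))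
      else if j == next_level i then skolem_up x y i
      else skolem_up y x j
  | inl (x, i), inr _ => skolem_inf x i
  | inr _, inl (x, i) => skolem_inf x i
  | inr _, inr _ => p
  end.

Lemma skolem_sym : commutative skolem_op.
Proof.
case=> [[x i]|o] [[y j]|o'] //=; last by rewrite (I1 o o').
case: (next_levelP i j) => ->.
- by rewrite !eqxx eq_sym cC; case: eqP => // ->.
- by rewrite (eq_sym i) !next_level_neq eqxx (eq_sym i) next_level2_neq.
- rewrite (eq_sym j (ordS j)) (eq_sym j (ordS (ordS j))).
  by rewrite !next_level_neq eqxx next_level2_neq.
Qed.

Lemma skolem_same x y i :
  skolem_op (inl (x, i)) (inl (y, i)) =
  if x == y then inl (x, i) else inl (c x y, next_level i).
Proof. by rewrite /= eqxx. Qed.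

Lemma skolem_next x y i :
  skolem_op (inl (x, i)) (inl (y, next_level i)) = skolem_up x y i.
Proof. by rewrite /= eq_sym next_level_neq eqxx. Qed.

Lemma skolem_prev x y i :
  skolem_op (inl (x, next_level i)) (inl (y, i)) = skolem_up y x i.
Proof. by rewrite skolem_sym skolem_next. Qed.

Lemma pickI (o : I) (p : X) :
  (if [pick o : I] is Some o' then inr o' else p) = inr o.
Proof. by case: pickP => [o' _|/(_ o)//]; rewrite (I1 o o'). Qed.

Lemma skolem_steiner : steiner_op skolem_op.
Proof.
split; first by case=> [[x i]|o] //=; rewrite !eqxx.
  exact: skolem_sym.
case=> [[x i]|o] [[y j]|o'] //.
- case: (next_levelP i j) => [->|->|->].
  + rewrite skolem_same; have [->|xy] := eqVneq x y.
      by rewrite skolem_same eqxx.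
    by rewrite skolem_next /skolem_up dcK eq_sym xy.
  + rewrite skolem_next /skolem_up; have [dE|dx] := eqVneq (d x y) x; last first.
      by rewrite skolem_same eq_sym (negPf dx) cdK.
    have sqx : c x x = y by rewrite -{2}dE cdK.
    have [xy|xy] := eqVneq x y.
      rewrite -xy in dE *; rewrite -{1}(next_levelK i) skolem_prev /skolem_up dE !eqxx /=.
      by rewrite next_levelK.
    have sqn : c x x != x by rewrite sqx eq_sym.
    have [o] := I_inh sqn; rewrite (pickI o) /= /skolem_inf.
    by rewrite (negPf sqn) sqx.
  + rewrite skolem_prev /skolem_up; have [dE|dy] := eqVneq (d y x) y; last first.
      rewrite skolem_prev /skolem_up.
      have -> : d (d y x) x = y by rewrite -{2}(cdK y x) cC dcK.
      by rewrite eq_sym dy.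
    have sqy : c y y = x by rewrite -{2}dE cdK.
    have [yx|yx] := eqVneq y x.
      rewrite yx in dE *; by rewrite skolem_next /skolem_up dE !eqxx /= next_levelK.
    have sqn : c y y != y by rewrite sqy eq_sym.
    have [o] := I_inh sqn; rewrite (pickI o) /= /skolem_inf -sqy sq_idem eqxx.
    by rewrite sqK // next_levelK.
- rewrite [skolem_op _ (inr o')]/(skolem_inf x i) /skolem_inf.
  have [sqx|sqx] := eqVneq (c x x) x.
    have rn := root_neq (inhabits o') sqx; have rK := rootK (inhabits o') sqx.
    rewrite -{1}(next_levelK i) skolem_prev.
    have dr : d (root x) x = root x by rewrite -{2}rK dcK.
    rewrite /skolem_up dr eqxx /=.
    by rewrite (negPf rn) (pickI o').
  rewrite skolem_next /skolem_up dcK eqxx /=.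
  by rewrite eq_sym (negPf sqx) (pickI o').
- rewrite /= /skolem_inf; have [sqy|sqy] := eqVneq (c y y) y; last first.
    by rewrite /= /skolem_inf sq_idem eqxx sqK // next_levelK.
  have rn := root_neq (inhabits o) sqy; have rK := rootK (inhabits o) sqy.
  by rewrite /= /skolem_inf rK eq_sym (negPf rn) next_levelK.
- by rewrite /= (I1 o o').
Qed.

End Skolem.

(* [half_sum x y] is the commutative quasigroup with addition table [x + y] mod
   [N] whose symbols are relabelled so that [2 x] becomes [x] for
   [x < uphalf N]; [unhalf] undoes the relabelling. *)
Section HalfSum.

Variable n : nat.
Local Notation N := n.+1.
Implicit Types x y z : 'I_N.

Definition addm (x y : nat) := if x + y < N then x + y else x + y - N.
Definition subm (x y : nat) := if y <= x then x - y else x + N - y.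
Definition unhalf (x : nat) :=
  if x < uphalf N then x.*2 else (x - uphalf N).*2.+1.
Definition halfm (s : nat) := if odd s then uphalf N + s./2 else s./2.

Definition half_sum x y : 'I_N := inord (halfm (addm x y)).
Definition half_div x y : 'I_N := inord (subm (unhalf y) x).
Definition half_root x : 'I_N := inord (x + uphalf N).

Lemma addm_lt (x y : nat) : x < N -> y < N -> addm x y < N.
Proof. by rewrite /addm; case: ifP; lia. Qed.

Lemma subm_lt (x y : nat) : x < N -> y < N -> subm x y < N.
Proof. by rewrite /subm; case: ifP; lia. Qed.

Lemma halfm_lt s : s < N -> halfm s < N.
Proof. by rewrite /halfm; case: ifP; lia. Qed.

Lemma unhalf_lt x : unhalf x < N.
Proof. by have := ltn_ord x; rewrite /unhalf; case: ifP; lia. Qed.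

Lemma unhalfK (x : nat) : halfm (unhalf x) = x.
Proof. by rewrite /halfm /unhalf; case: (ltnP x (uphalf N)); case: ifP; lia. Qed.

Lemma halfmK s : s < N -> unhalf (halfm s) = s.
Proof. by rewrite /halfm /unhalf; case: (boolP (odd s)); case: ifP; lia. Qed.

Lemma val_half_sum x y : half_sum x y = halfm (addm x y) :> nat.
Proof. by rewrite inordK // halfm_lt // addm_lt. Qed.

Lemma unhalf_half_sum x y : unhalf (half_sum x y) = addm x y.
Proof. by rewrite val_half_sum halfmK // addm_lt. Qed.

Lemma half_sumC : commutative half_sum.
Proof. by move=> x y; rewrite /half_sum /addm addnC. Qed.

Lemma half_sum_eq x y z : addm x y = unhalf z -> half_sum x y = z.
Proof. by move=> E; apply: val_inj; rewrite /= val_half_sum E unhalfK. Qed.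

Lemma half_divK x y : half_sum x (half_div x y) = y.
Proof.
apply: half_sum_eq; have := ltn_ord x; have := unhalf_lt y.
rewrite inordK ?subm_lt //; last exact: unhalf_lt.
by move: (unhalf y) => u; rewrite /addm /subm; case: (leqP x u); case: ifP; lia.
Qed.

Lemma half_sumK x y : half_div x (half_sum x y) = y.
Proof.
apply: val_inj; rewrite /= /half_div unhalf_half_sum.
have := ltn_ord x; have := ltn_ord y => yN xN.
rewrite inordK ?subm_lt ?addm_lt //.
by rewrite /addm /subm; case: (ltnP (x + y)); case: ifP; lia.
Qed.

(** For odd [N] every element is idempotent. For even [N], [x] and [x - N / 2] have the same double,
    and the idempotents form the lower half. *)
Lemma val_half_sq x :
  half_sum x x = (if odd N || (x < uphalf N) then x : nat else x - uphalf N)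
    :> nat.
Proof.
have := ltn_ord x; rewrite val_half_sum /halfm /addm.
by case: (ltnP (x + x)); case: ifP; case: ifP; lia.
Qed.

Lemma half_sqP x : (half_sum x x == x) = odd N || (x < uphalf N).
Proof.
rewrite -(inj_eq val_inj) /= val_half_sq; have := ltn_ord x.
by case: ifP; lia.
Qed.

Lemma half_sq_idem x : half_sum (half_sum x x) (half_sum x x) = half_sum x x.
Proof.
apply/eqP; rewrite half_sqP val_half_sq; have := ltn_ord x.
by case: ifP; lia.
Qed.

Lemma half_sqK x : half_sum x x != x -> half_root (half_sum x x) = x.
Proof.
rewrite half_sqP => xN; apply: val_inj; rewrite /half_root val_half_sq.
by rewrite (negPf xN) /= inordK; have := ltn_ord x; lia.
Qed.

Lemma val_half_root x : ~~ odd N -> half_sum x x = x ->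
  half_root x = x + uphalf N :> nat.
Proof. by move=> oN /eqP; rewrite half_sqP => xN; rewrite inordK; lia. Qed.

Lemma half_rootK x : ~~ odd N -> half_sum x x = x ->
  half_sum (half_root x) (half_root x) = x.
Proof.
move=> oN xx; apply: val_inj; rewrite /= val_half_sq val_half_root //.
by rewrite (negPf oN); case: ifP; lia.
Qed.

Lemma half_root_neq x : ~~ odd N -> half_sum x x = x -> half_root x != x.
Proof.
by move=> oN xx; rewrite -(inj_eq val_inj) /= val_half_root //; lia.
Qed.

(** This kills level 1: points of level 0 whose codes exceed [2 * K] are all played. *)
Lemma half_sum_cover K z : 10 * K + 20 < N -> exists x y,
  [/\ x != y, 2 * K < unhalf x, 2 * K < unhalf y & half_sum x y = z].
Proof.
move=> KN; have zN := unhalf_lt z.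
(* Codes are large off two short intervals, starting at 0 and at [uphalf N]; it remains to choose
   integers avoiding both, with or without wraparound. *)
have pick (x y : nat) : x < N -> y < N -> x != y -> K < x ->
    ~~ (uphalf N <= x <= uphalf N + K) -> K < y ->
    ~~ (uphalf N <= y <= uphalf N + K) ->
    x + y = unhalf z \/ x + y = unhalf z + N -> exists x y : 'I_N,
  [/\ x != y, 2 * K < unhalf x, 2 * K < unhalf y & half_sum x y = z].
  move=> xN yN xy xK xH yK yH xyz; exists (inord x), (inord y).
  rewrite -(inj_eq val_inj) /= !inordK // xy; split=> //.
  - by rewrite /unhalf; case: ifP; lia.
  - by rewrite /unhalf; case: ifP; lia.
  - by apply: half_sum_eq; rewrite !inordK // /addm; case: ifP; lia.
move: (unhalf z) zN pick => r rN pick.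
have [r1|r1] := leqP r (uphalf N - 2).
  apply: (pick (maxn K.+1 r.+1) (r + N - maxn K.+1 r.+1)); lia.
have [r2|r2] := ltnP r (uphalf N + 2 * K + 2).
  apply: (pick (r - (uphalf N - 2 - K)) (uphalf N - 2 - K)); lia.
apply: (pick K.+1 (r - K.+1)); lia.
Qed.

End HalfSum.

(** * The played position in the Bose-Skolem system *)

Section Design.

Variables (V : finType) (e : rel V) (K n : nat) (f : V -> nat) (T E : pred nat).
Local Notation N := n.+1.
Hypothesis e_sym : symmetric e.
Hypothesis e_irr : irreflexive e.
Hypothesis KN : 10 * K + 20 < N.
Hypothesis f_inj : injective f.
Hypothesis fK : forall v, f v <= K.
Hypothesis fT : forall v, ~~ T (f v).
Hypothesis T0 : T 0.
Hypothesis TK : T K.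
Hypothesis T_le : forall x, T x -> x <= K.
Hypothesis E_ge : forall z, 2 * K <= z -> E z.
Hypothesis TTE : forall x y, T x -> T y -> x != y -> ~~ E (x + y).
Hypothesis TfE : forall x v, T x -> ~~ E (x + f v).
Hypothesis ffE : forall u v, u != v -> E (f u + f v) = e u v.
Hypothesis T_dom : forall y, y <= K -> ~~ T y -> (forall v, y != f v) ->
  exists t, [/\ T t, t != y & E (t + y)].
Hypothesis T_cover : forall z, ~~ E z ->
  exists x y, [/\ x != y, T x, T y & x + y = z].

(** The boolean is read as a number, giving a point at infinity exactly when [N] is even. *)
Local Notation I := 'I_(~~ odd N).
Local Notation X := ('I_N * 'I_3 + I)%type.
Local Notation c := (@half_sum n).
Local Notation op := (@skolem_op 'I_N I c (@half_div n) (@half_root n)).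
Local Notation l2 := (ord_max : 'I_3).
Local Notation l0 := (@ordS 3 l2).
Local Notation l1 := (@ordS 3 l0).

Let I_even : inhabited I -> ~~ odd N.
Proof. by case=> -[k]; case: odd. Qed.

Let I1 (o o' : I) : o = o'.
Proof.
by apply: val_inj; case: o o' => k kI [k' kI'] /=; case: odd kI kI' => //=; lia.
Qed.

Lemma design_op_steiner : steiner_op op.
Proof.
apply: skolem_steiner.
- exact: half_sumC.
- exact: half_divK.
- exact: half_sumK.
- exact: I1.
- move=> x; rewrite half_sqP negb_or => /andP[oN _].
  by constructor; exists 0; rewrite oN.
- exact: half_sq_idem.
- exact: half_sqK.
- by move/I_even => oN x; apply: half_rootK.
- by move/I_even => oN x; apply: half_root_neq.
Qed.

(* The points played at level [l0] are those labelled by [E]; no point of level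
   [l1] is played. *)
Definition played (p : X) : bool :=
  match p with
  | inl (x, i) => if i == l0 then E (unhalf n x) else (i == l2) && T x
  | inr _ => true
  end.

Definition vertex (v : V) : X := inl (inord (f v), l2).

Let fN v : f v < N. Proof. by have := fK v; lia. Qed.
Let TN x : T x -> x < N. Proof. by move/T_le; lia. Qed.

Let vertexE v : inord (f v) = f v :> nat := inordK (fN v).

Lemma playedP p : played p ->
  [\/ exists2 x, p = inl (x, l0) & E (unhalf n x),
      exists2 x, p = inl (x, l2) & T x
    | exists o, p = inr o].
Proof.
case: p => [[x i]|o] /=; last by constructor 3; exists o.
case: eqP => [-> Ex|_ /andP[/eqP-> Tx]].
  by constructor 1; exists x.
by constructor 2; exists x.
Qed.

Let fresh p := ~~ played p && [forall v, p != vertex v].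

Let fresh1 x : fresh (inl (x, l1)).
Proof. by rewrite /fresh /=; apply/forallP => v; apply/eqP => -[]. Qed.

Let fresh0 (x : 'I_N) : ~~ E (unhalf n x) -> fresh (inl (x, l0)).
Proof.
by move=> nE; rewrite /fresh /= nE; apply/forallP => v; apply/eqP => -[].
Qed.

Let fresh2 (x : 'I_N) : ~~ T x -> (forall v, nat_of_ord x != f v) -> fresh (inl (x, l2)).
Proof.
move=> nT nf; rewrite /fresh /= nT /=; apply/forallP => v.
by apply/eqP => -[xE]; have := nf v; rewrite xE vertexE eqxx.
Qed.

Let small_sq (x : 'I_N) : x <= K -> c x x = x.
Proof. by move=> xK; apply/eqP; rewrite half_sqP; lia. Qed.

Let small_sum (x y : 'I_N) : x <= K -> y <= K -> unhalf n (c x y) = x + y.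
Proof. by move=> xK yK; rewrite unhalf_half_sum /addm; case: ifP; lia. Qed.

(** A third point on level 1 is always fresh. On level 0 its code is a sum from [T], hence not in
    [E]. On level 2 it is either adjacent to a point of [T], so neither in [T] nor a vertex, or
    obtained from infinity and beyond [K]. *)
Lemma played_fresh p q : p != q -> played p -> played q -> fresh (op p q).
Proof.
have opC := (let: And3 _ h _ := design_op_steiner in h).
have c02 (s t : 'I_N) : E (unhalf n s) -> T t ->
    fresh (op (inl (s, l0)) (inl (t, l2))).
  move=> Es Tt; rewrite skolem_prev; [|exact: half_sumC|exact: I1].
  rewrite /skolem_up; have tK := T_le Tt.
  have [dE|dt] := eqVneq (half_div t s) t; last first.
    rewrite /=; have ctd := half_divK t s; move: (half_div t s) dt ctd => z zt ctz.
    have Ez : z <= K -> E (t + z) by move=> zK; rewrite -small_sum // ctz.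
    apply: fresh2 => [|v].
      apply/negP => Tz; have := TTE Tt Tz; rewrite Ez ?T_le //.
      by rewrite eq_sym (inj_eq val_inj) zt => /(_ isT).
    apply/eqP => zE; have := TfE v Tt; rewrite -zE Ez //.
    by rewrite zE.
  rewrite /=; have [_|ts] := eqVneq t s; first exact: fresh1.
  by case/eqP: ts; rewrite -(half_divK t s) dE small_sq.
have c0i : forall (s : 'I_N) o, E (unhalf n s) -> fresh (op (inl (s, l0)) (inr o)).
  move=> s o Es; rewrite /= /skolem_inf; case: eqP => [ss|_]; last exact: fresh1.
  have oN : ~~ odd N by apply: I_even.
  have rs := val_half_root oN ss; apply: (fresh2 (x := half_root s)).
    by apply/negP => /T_le; rewrite rs; lia.
  by move=> v; rewrite rs; have := fK v; lia.
have c2i : forall (t : 'I_N) o, T t -> fresh (op (inl (t, l2)) (inr o)).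
  by move=> t o Tt; rewrite /= /skolem_inf small_sq ?T_le // eqxx; apply: fresh1.
move=> pq /playedP[[x xE Px]|[x xE Px]|[o oE]]
  /playedP[[y yE Py]|[y yE Py]|[o' oE']].
- rewrite xE yE skolem_same; case: eqP => [xy|_]; last exact: fresh1.
  by rewrite xE yE xy eqxx in pq.
- by rewrite xE yE; apply: c02.
- by rewrite xE oE'; apply: c0i.
- by rewrite xE yE opC; apply: c02.
- rewrite xE yE skolem_same; case: eqP => [xy|/eqP xy].
    by rewrite xE yE xy eqxx in pq.
  by apply: fresh0; rewrite small_sum ?T_le //; apply: TTE.
- by rewrite xE oE'; apply: c2i.
- by rewrite oE yE opC; apply: c0i.
- by rewrite oE yE opC; apply: c2i.
- by rewrite oE oE' (I1 o o') eqxx in pq.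
Qed.

Lemma played_dead x : ~~ played x -> (forall v, x != vertex v) ->
  exists p q, [/\ p != q, played p, played q & op p q = x].
Proof.
have [_ _ opK] := design_op_steiner.
case: x => [[x i]|//] xP xf.
have [i0|i1|i2] : [\/ i = l0, i = l1 | i = l2].
- by case: (next_levelP l2 i) => [->|->|E2]; [constructor 3|constructor 1|
    constructor 2; rewrite E2 next_levelK].
- subst i; have [s [t [st Ts Tt stE]]] : exists s t,
      [/\ s != t, T s, T t & s + t = unhalf n x] by apply: T_cover.
  exists (inl (inord s, l2)), (inl (inord t, l2)).
  have vs : inord s = s :> nat := inordK (TN Ts).
  have vt : inord t = t :> nat := inordK (TN Tt).
  have nst : (inord s : 'I_N) != inord t by rewrite -(inj_eq val_inj) /= vs vt.
  split=> /=; rewrite ?vs ?vt //.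
    by apply: contraNneq nst => -[->].
  rewrite (negPf nst) (half_sum_eq (z := x)) //.
  by rewrite vs vt /addm stE unhalf_lt.
- subst i; have [s [t [st s2 t2 stE]]] := half_sum_cover x KN.
  exists (inl (s, l0)), (inl (t, l0)); split=> /=.
  + by apply: contraNneq st => -[->].
  + by apply: E_ge; lia.
  + by apply: E_ge; lia.
  + by rewrite (negPf st) stE.
subst i; have nT : ~~ T x by [].
have nf v : nat_of_ord x != f v.
  by apply: contraNneq (xf v) => xv; rewrite /vertex -xv inord_val.
(* Up to [K] the domination of [T] applies. Beyond, [K] serves up to [2 * K] and 0 afterwards: the
   sums are at least [2 * K] and do not wrap around. *)
have [t [Tt tx Et]] : exists t, [/\ T t, t != x & E (addm n t x)].
  have xN := ltn_ord x; have [xK|xK] := leqP x K.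
    have [t [Tt tx Et]] := T_dom xK nT nf; exists t; split=> //.
    by rewrite /addm ifT //; have := T_le Tt; lia.
  have [x2|x2] := leqP x (2 * K).
    exists K; split=> //; first lia.
    by apply: E_ge; rewrite /addm; case: ifP; lia.
  exists 0; split=> //; first lia.
  by apply: E_ge; rewrite /addm; case: ifP; lia.
have vt : inord t = t :> nat := inordK (TN Tt).
have ntx : (inord t : 'I_N) != x by rewrite -(inj_eq val_inj) /= vt.
exists (inl (inord t, l2)), (inl (c (inord t) x, l0)); split=> //.
- by apply/eqP => -[].
- by rewrite /= vt Tt.
- by rewrite /= unhalf_half_sum vt.
- have := opK (inl (inord t, l2)) (inl (x, l2)).
  by rewrite skolem_same (negPf ntx).
Qed.

Lemma design_position :
  [/\ steiner_triple_system (op_blocks op) /\ #|X : finType| = 3 * N + ~~ odd N,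
      block_free (op_blocks op) [set p | played p],
      is_graph (available_hypergraph (op_blocks op) [set p | played p]) /\
        hypergraph_iso (graph_hypergraph e)
          (available_hypergraph (op_blocks op) [set p | played p]),
      nofil_follower (op_blocks op) [set p | played p]
    & @game_equiv (nofil (op_blocks op)) (node_kayles e)
        [set p | played p] set0].
Proof.
have opS := design_op_steiner.
have fresh_op p q : p != q -> p \in [set p | played p] ->
    q \in [set p | played p] -> fresh (op p q).
  by rewrite !inE; apply: played_fresh.
have inf_inj : injective vertex.
  by move=> u v [/(congr1 val)]; rewrite /= !vertexE => /f_inj.
have vv u v : u != v -> op (vertex u) (vertex v) =
    inl (c (inord (f u)) (inord (f v)), l0).
  move=> uv; rewrite skolem_same -(inj_eq val_inj) /= !vertexE.
  by rewrite (inj_eq f_inj) (negPf uv).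
have [] := @steiner_op_position X op opS V e vertex [set p | played p].
- exact: e_sym.
- exact: e_irr.
- exact: inf_inj.
- by move=> p q pq pP qP; have /andP[] := fresh_op p q pq pP qP; rewrite inE.
- by move=> v; rewrite inE /= vertexE.
- by move=> p q v pq pP qP; have /andP[_ /forallP] := fresh_op p q pq pP qP.
- move=> x; rewrite inE => xP xf.
  have [p [q [pq pP qP opE]]] := played_dead xP xf.
  by exists p, q; rewrite !inE.
- by move=> u v uv; rewrite vv // inE /= small_sum ?vertexE // ffE.
- by move=> u v w uv; rewrite vv //; apply/eqP => -[].
move=> bf gr fo ge; split=> //; split; first exact: op_blocks_steiner.
by rewrite card_sum card_prod !card_ord mulnC.
Qed.

End Design.

Theorem theorem4p2 (V : finType) (e : rel V)
    (e_sym : symmetric e) (e_irr : irreflexive e) :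
  exists vG : nat, forall v : nat, vG <= v ->
    v = 1 %[mod 6] \/ v = 3 %[mod 6] ->
    exists (X : finType) (B : {set {set X}}) (P : {set X}),
      [/\ steiner_triple_system B /\ #|X| = v,
          block_free B P,
          is_graph (available_hypergraph B P) /\
            hypergraph_iso (graph_hypergraph e) (available_hypergraph B P),
          nofil_follower B P
        & @game_equiv (nofil B) (node_kayles e) P set0].
Proof.
have [K [f [T [E [f_inj fK [T0 TK T_le E_ge] [TTE TfE ffE] [T_dom T_cov]]]]]] :=
  sum_graph e_sym e_irr.
exists (30 * K + 70) => v vK v6.
(* Orders 3 modulo 6 come from odd [N] (Bose), orders 1 modulo 6 from even [N] with infinity
   (Skolem); in both cases [N] is [v %/ 3]. *)
have [n [nK vE]] : exists n, 10 * K + 20 < n.+1 /\ v = 3 * n.+1 + ~~ odd n.+1.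
  by exists (v %/ 3).-1; lia.
have [] := @design_position V e K n f T E e_sym e_irr nK f_inj
  (fun v => (fK v).1) (fun v => (fK v).2) T0 TK T_le E_ge TTE TfE ffE T_dom T_cov.
by rewrite -vE => ? ? ? ? ?; do 3 eexists; split; eassumption.
Qed.
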